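(* Let $a, b > 0$ be real numbers, let $w_n = an+b$ for $n \ge 0$, and let $M$ be the weighted mean matrix associated with the weight sequence $\{w_n\}_{n\ge 0}$, i.e. the lower triangular infinite matrix $M = [m_{ij}]_{i,j \ge 0}$ with $m_{ij} = w_j / W_i$ for $j \le i$ and $m_{ij} = 0$ for $j > i$, where $W_i = \sum_{j=0}^{i} w_j$. Then $M$ is a coposinormal operator on $\ell^2$.
   Context: Here $\ell^2$ is the Hilbert space of square-summable sequences indexed by $n = 0, 1, 2, \dots$, and an infinite matrix acts on $\ell^2$ with respect to the standard orthonormal basis by $(Mf)_i = \sum_j m_{ij} f_j$. For a Hilbert space $H$, $\mathcal{B}(H)$ denotes the set of all bounded linear operators on $H$. An operator $A \in \mathcal{B}(H)$ is posinormal if $AA^* = A^*PA$ for some positive operator $P \in \mathcal{B}(H)$, where positive means $\langle Pf, f\rangle \ge 0$ for all $f \in H$. The operator $A$ is coposinormal if its adjoint $A^*$ is posinormal. Thus calling $M$ a coposinormal operator on $\ell^2$ includes that $M$ defines a bounded operator on $\ell^2$. *)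

(* Defs.v *)
From Stdlib Require Import Reals Lra Arith FunctionalExtensionality Classical.
From Coquelicot Require Import Coquelicot.

Open Scope R_scope.

(** * The complex Hilbert space of square-summable sequences *)

Record ell2 : Type := mk_ell2 {
  ell2_seq :> nat -> C;
  ell2_summable : ex_series (fun n => Cmod (ell2_seq n) ^ 2)
}.

Lemma ell2_eq (f g : ell2) : (forall n, f n = g n) -> f = g.
Proof.
destruct f as [f hf], g as [g hg]; simpl; intros h.
assert (e : f = g) by (apply functional_extensionality; exact h).
subst g; f_equal; apply proof_irrelevance.
Qed.

Lemma Cmod_sqr_plus_le (s : R) (x y : C) : 0 < s ->
  Cmod (x + y) ^ 2 <= (1 + s) * Cmod x ^ 2 + (1 + / s) * Cmod y ^ 2.
Proof.
intros hs.
apply Rle_trans with ((Cmod x + Cmod y) ^ 2).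
- apply pow_incr; split; [apply Cmod_ge_0 | apply Cmod_triangle].
- generalize (Cmod x) (Cmod y); intros p q.
  assert (h : (1 + s) * p ^ 2 + (1 + / s) * q ^ 2 - (p + q) ^ 2
              = / s * (s * p - q) ^ 2) by (field; lra).
  assert (0 <= / s * (s * p - q) ^ 2).
  { apply Rmult_le_pos; [left; now apply Rinv_0_lt_compat | apply pow2_ge_0]. }
  lra.
Qed.

Lemma ex_series_lin2 (c d : R) (u v : nat -> R) : ex_series u -> ex_series v ->
  ex_series (fun n => c * u n + d * v n).
Proof.
intros hu hv.
apply (ex_series_plus (V := R_NormedModule) (fun n => c * u n) (fun n => d * v n)).
- exact (ex_series_scal (V := R_NormedModule) c u hu).
- exact (ex_series_scal (V := R_NormedModule) d v hv).
Qed.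

Lemma Series_lin2 (c d : R) (u v : nat -> R) : ex_series u -> ex_series v ->
  Series (fun n => c * u n + d * v n) = c * Series u + d * Series v.
Proof.
intros hu hv.
rewrite Series_plus; [now rewrite !Series_scal_l | |].
- exact (ex_series_scal (V := R_NormedModule) c u hu).
- exact (ex_series_scal (V := R_NormedModule) d v hv).
Qed.

Lemma ell2_plus_summable (f g : ell2) :
  ex_series (fun n => Cmod (f n + g n) ^ 2).
Proof.
apply (ex_series_le (V := R_CompleteNormedModule))
  with (fun n => (1 + 1) * Cmod (f n) ^ 2 + (1 + / 1) * Cmod (g n) ^ 2).
- intros n. unfold norm; simpl; unfold abs; simpl.
  rewrite Rabs_pos_eq.
  + exact (Cmod_sqr_plus_le 1 (f n) (g n) Rlt_0_1).
  + exact (pow2_ge_0 _).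
- apply ex_series_lin2; apply ell2_summable.
Qed.

Lemma ell2_scal_summable (c : C) (f : ell2) :
  ex_series (fun n => Cmod (c * f n) ^ 2).
Proof.
apply ex_series_ext with (fun n => scal (Cmod c ^ 2) (Cmod (f n) ^ 2)).
- intros n; rewrite Cmod_mult; unfold scal; simpl; unfold mult; simpl; ring.
- exact (ex_series_scal (V := R_NormedModule) _ _ (ell2_summable f)).
Qed.

Lemma ell2_zero_summable : ex_series (fun _ : nat => Cmod 0 ^ 2).
Proof.
exists 0.
apply (is_lim_seq_ext (fun _ => 0) _ (Finite 0)); [| apply is_lim_seq_const].
intros n; rewrite sum_n_const, Cmod_0; ring.
Qed.

Definition ell2_zero : ell2 := mk_ell2 (fun _ => RtoC 0) ell2_zero_summable.
Definition ell2_plus (f g : ell2) : ell2 :=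
  mk_ell2 (fun n => (f n + g n)%C) (ell2_plus_summable f g).
Definition ell2_scal (c : C) (f : ell2) : ell2 :=
  mk_ell2 (fun n => (c * f n)%C) (ell2_scal_summable c f).
Definition ell2_opp (f : ell2) : ell2 := ell2_scal (RtoC (-1)) f.

Definition ell2_norm (f : ell2) : R := sqrt (Series (fun n => Cmod (f n) ^ 2)).

Lemma Series_nonneg (u : nat -> R) : (forall n, 0 <= u n) -> ex_series u ->
  0 <= Series u.
Proof.
intros hu hs.
rewrite <- (Rmult_0_l (Series u)), <- Series_scal_l.
apply Series_le; [| exact hs].
intros n; rewrite Rmult_0_l; split; [apply Rle_refl | apply hu].
Qed.

Lemma ell2_norm_ge0 (f : ell2) : 0 <= ell2_norm f.
Proof. apply sqrt_pos. Qed.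

Lemma ell2_norm_sqr (f : ell2) :
  ell2_norm f ^ 2 = Series (fun n => Cmod (f n) ^ 2).
Proof.
apply pow2_sqrt, Series_nonneg; [intros n; apply pow2_ge_0 | apply ell2_summable].
Qed.

Lemma ell2_norm_triangle (f g : ell2) :
  ell2_norm (ell2_plus f g) <= ell2_norm f + ell2_norm g.
Proof.
assert (hf := ell2_norm_ge0 f). assert (hg := ell2_norm_ge0 g).
apply Rle_plus_epsilon; intros e he.
set (p := ell2_norm f + e / 2). set (q := ell2_norm g + e / 2).
assert (hp : 0 < p) by (unfold p; lra).
assert (hq : 0 < q) by (unfold q; lra).
replace (ell2_norm f + ell2_norm g + e) with (p + q) by (unfold p, q; lra).
apply Rsqr_incr_0_var; [| lra]. rewrite !Rsqr_pow2, ell2_norm_sqr; simpl ell2_seq.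
assert (hs : 0 < q / p) by now apply Rdiv_lt_0_compat.
apply Rle_trans with
  ((1 + q / p) * ell2_norm f ^ 2 + (1 + / (q / p)) * ell2_norm g ^ 2).
- rewrite !ell2_norm_sqr, <- Series_lin2 by apply ell2_summable.
  apply Series_le.
  + intros n; split; [apply pow2_ge_0 | now apply Cmod_sqr_plus_le].
  + apply ex_series_lin2; apply ell2_summable.
- replace ((p + q) ^ 2)
    with ((1 + q / p) * p ^ 2 + (1 + / (q / p)) * q ^ 2) by (field; lra).
  assert (0 < / (q / p)) by now apply Rinv_0_lt_compat.
  apply Rplus_le_compat; apply Rmult_le_compat_l; try lra;
    apply pow_incr; unfold p, q; lra.
Qed.

Lemma ell2_norm_scal (c : C) (f : ell2) :
  ell2_norm (ell2_scal c f) = Cmod c * ell2_norm f.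
Proof.
unfold ell2_norm; simpl ell2_seq.
rewrite (Series_ext _ (fun n => Cmod c ^ 2 * Cmod (f n) ^ 2)).
- rewrite Series_scal_l, sqrt_mult_alt by apply pow2_ge_0.
  now rewrite sqrt_pow2 by apply Cmod_ge_0.
- intros n; rewrite Cmod_mult; ring.
Qed.

Lemma ell2_norm_opp (f : ell2) : ell2_norm (ell2_opp f) = ell2_norm f.
Proof.
unfold ell2_opp; rewrite ell2_norm_scal, Cmod_R, (Rabs_left (-1)) by lra; ring.
Qed.

Lemma ell2_norm_eq0 (f : ell2) : ell2_norm f = 0 -> f = ell2_zero.
Proof.
intros h; apply ell2_eq; intros n; simpl.
apply Cmod_eq_0.
assert (hs : Series (fun n => Cmod (f n) ^ 2) = 0)
  by (rewrite <- ell2_norm_sqr, h; ring).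
assert (hle : Cmod (f n) ^ 2 <= 0).
{ rewrite <- hs.
  apply Rle_trans with (sum_n (fun n => Cmod (f n) ^ 2) n).
  - destruct n as [| n]; [rewrite sum_O; apply Rle_refl |].
    rewrite sum_Sn.
    assert (0 <= sum_n (fun n => Cmod (f n) ^ 2) n).
    { rewrite sum_n_Reals; apply cond_pos_sum; intros k; apply pow2_ge_0. }
    unfold plus; simpl; simpl in H; lra.
  - apply (is_lim_seq_incr_compare (sum_n (fun n => Cmod (f n) ^ 2))).
    + exact (Series_correct _ (ell2_summable f)).
    + intros k; rewrite sum_Sn.
      assert (hk := pow2_ge_0 (Cmod (f (S k)))).
      unfold plus; simpl; simpl in hk; lra. }
assert (h0 := Cmod_ge_0 (f n)).
destruct h0 as [h0 | h0]; [| now symmetry].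
assert (0 < Cmod (f n) ^ 2) by now apply pow_lt. lra.
Qed.

(** The structures below make [ell2] a normed space over [C], so that
    Coquelicot's [is_linear] reads "bounded linear operator". *)

Lemma ell2_plus_comm (f g : ell2) : ell2_plus f g = ell2_plus g f.
Proof. apply ell2_eq; intros n; apply Cplus_comm. Qed.

Lemma ell2_plus_assoc (f g h : ell2) :
  ell2_plus f (ell2_plus g h) = ell2_plus (ell2_plus f g) h.
Proof. apply ell2_eq; intros n; apply Cplus_assoc. Qed.

Lemma ell2_plus_zero (f : ell2) : ell2_plus f ell2_zero = f.
Proof. apply ell2_eq; intros n; apply Cplus_0_r. Qed.

Lemma ell2_plus_opp (f : ell2) : ell2_plus f (ell2_opp f) = ell2_zero.
Proof. apply ell2_eq; intros n; simpl; ring. Qed.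

Definition ell2_AbelianMonoid_mixin := AbelianMonoid.Mixin ell2
  ell2_plus ell2_zero ell2_plus_comm ell2_plus_assoc ell2_plus_zero.

Canonical ell2_AbelianMonoid :=
  AbelianMonoid.Pack ell2 ell2_AbelianMonoid_mixin ell2.

Definition ell2_AbelianGroup_mixin :=
  AbelianGroup.Mixin ell2_AbelianMonoid ell2_opp ell2_plus_opp.

Canonical ell2_AbelianGroup := AbelianGroup.Pack ell2
  (AbelianGroup.Class _ ell2_AbelianMonoid_mixin ell2_AbelianGroup_mixin) ell2.

Lemma ell2_scal_assoc (c d : C) (f : ell2) :
  ell2_scal c (ell2_scal d f) = ell2_scal (c * d)%C f.
Proof. apply ell2_eq; intros n; apply Cmult_assoc. Qed.

Lemma ell2_scal_one (f : ell2) : ell2_scal (RtoC 1) f = f.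
Proof. apply ell2_eq; intros n; apply Cmult_1_l. Qed.

Lemma ell2_scal_plus_r (c : C) (f g : ell2) :
  ell2_scal c (ell2_plus f g) = ell2_plus (ell2_scal c f) (ell2_scal c g).
Proof. apply ell2_eq; intros n; apply Cmult_plus_distr_l. Qed.

Lemma ell2_scal_plus_l (c d : C) (f : ell2) :
  ell2_scal (c + d)%C f = ell2_plus (ell2_scal c f) (ell2_scal d f).
Proof. apply ell2_eq; intros n; apply Cmult_plus_distr_r. Qed.

Definition ell2_ModuleSpace_mixin :=
  ModuleSpace.Mixin C_Ring ell2_AbelianGroup ell2_scal
    ell2_scal_assoc ell2_scal_one ell2_scal_plus_r ell2_scal_plus_l.

Canonical ell2_ModuleSpace := ModuleSpace.Pack C_Ring ell2
  (ModuleSpace.Class _ _ (AbelianGroup.class ell2_AbelianGroup)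
     ell2_ModuleSpace_mixin) ell2.

Definition ell2_ball (f : ell2) (e : R) (g : ell2) : Prop :=
  ell2_norm (minus g f) < e.

Lemma ell2_ball_center (f : ell2) (e : posreal) : ell2_ball f e f.
Proof.
unfold ell2_ball; rewrite minus_eq_zero.
apply Rle_lt_trans with 0; [apply Req_le | exact (cond_pos e)].
change (ell2_norm ell2_zero = 0).
replace ell2_zero with (ell2_scal (RtoC 0) ell2_zero).
- rewrite ell2_norm_scal, Cmod_0; ring.
- apply ell2_eq; intros n; simpl; ring.
Qed.

Lemma ell2_ball_sym (f g : ell2) (e : R) : ell2_ball f e g -> ell2_ball g e f.
Proof.
unfold ell2_ball; intros h.
rewrite <- (opp_minus g f).
change (ell2_norm (ell2_opp (minus g f)) < e).
rewrite ell2_norm_opp; exact h.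
Qed.

Lemma ell2_ball_triangle (f g h : ell2) (e1 e2 : R) :
  ell2_ball f e1 g -> ell2_ball g e2 h -> ell2_ball f (e1 + e2) h.
Proof.
unfold ell2_ball; intros h1 h2.
rewrite (minus_trans g h f).
assert (ht := ell2_norm_triangle (minus h g) (minus g f)).
change (ell2_plus (minus h g) (minus g f))
  with (plus (minus h g) (minus g f)) in ht.
lra.
Qed.

Definition ell2_UniformSpace_mixin := UniformSpace.Mixin ell2 ell2_zero
  ell2_ball ell2_ball_center ell2_ball_sym ell2_ball_triangle.

Canonical ell2_UniformSpace :=
  UniformSpace.Pack ell2 ell2_UniformSpace_mixin ell2.

Canonical ell2_NormedModuleAux := NormedModuleAux.Pack C_AbsRing ell2
  (NormedModuleAux.Class _ _ (ModuleSpace.class _ ell2_ModuleSpace)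
     (UniformSpace.class ell2_UniformSpace)) ell2.

Lemma ell2_norm_scal_le (c : C) (f : ell2) :
  ell2_norm (ell2_scal c f) <= Cmod c * ell2_norm f.
Proof. apply Req_le, ell2_norm_scal. Qed.

Lemma ell2_norm_ball (f g : ell2) (e : R) :
  ell2_norm (minus g f) < e -> ell2_ball f e g.
Proof. exact (fun h => h). Qed.

Lemma ell2_ball_norm (f g : ell2) (e : posreal) :
  ell2_ball f e g -> ell2_norm (minus g f) < 1 * e.
Proof. rewrite Rmult_1_l; exact (fun h => h). Qed.

Definition ell2_NormedModule_mixin :=
  NormedModule.Mixin C_AbsRing ell2_NormedModuleAux ell2_norm 1
    ell2_norm_triangle ell2_norm_scal_le ell2_norm_ball ell2_ball_norm
    ell2_norm_eq0.

Canonical ell2_NormedModule := NormedModule.Pack C_AbsRing ell2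
  (NormedModule.Class _ _ (NormedModuleAux.class _ ell2_NormedModuleAux)
     ell2_NormedModule_mixin) ell2.

Definition ell2_inner (f g : ell2) : C :=
  (Series (fun n => Re (f n * Cconj (g n))),
   Series (fun n => Im (f n * Cconj (g n)))).

Lemma Cmod_mult_conj_le (x y : C) :
  Cmod (x * Cconj y) <= 1 * Cmod x ^ 2 + 1 * Cmod y ^ 2.
Proof.
rewrite Cmod_mult, Cmod_conj.
assert (h := pow2_ge_0 (Cmod x - Cmod y)).
assert (hx := pow2_ge_0 (Cmod x)). assert (hy := pow2_ge_0 (Cmod y)).
simpl in *; lra.
Qed.

(** The coordinatewise sums defining [ell2_inner] always converge, so it is the
    sum in [C] of the series with terms [f n * Cconj (g n)]. *)
Lemma ell2_inner_correct (f g : ell2) :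
  is_series (fun n => (f n * Cconj (g n))%C) (ell2_inner f g).
Proof.
assert (hdom : forall u : nat -> R,
  (forall n, Rabs (u n) <= Cmod (f n * Cconj (g n))) -> ex_series u).
{ intros u hu.
  apply (ex_series_le (V := R_CompleteNormedModule))
    with (fun n => 1 * Cmod (f n) ^ 2 + 1 * Cmod (g n) ^ 2).
  - intros n; apply Rle_trans with (1 := hu n); apply Cmod_mult_conj_le.
  - apply ex_series_lin2; apply ell2_summable. }
assert (hre := Series_correct _ (hdom (fun n => Re (f n * Cconj (g n)))
                 (fun n => re_le_Cmod _))).
assert (him := Series_correct _ (hdom (fun n => Im (f n * Cconj (g n)))
                 (fun n => Rle_trans _ _ _ (Rmax_r _ _) (Rmax_Cmod _)))).
unfold is_series in *.
apply filterlim_locally; intros e.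
assert (hs : forall (z : nat -> C) n, sum_n z n =
  (sum_n (fun k => Re (z k)) n, sum_n (fun k => Im (z k)) n)).
{ intros z n; induction n as [| n IH].
  - rewrite !sum_O; apply surjective_pairing.
  - rewrite !sum_Sn, IH; reflexivity. }
apply filter_imp with (2 := filter_and _ _
  (proj1 (filterlim_locally _ _) hre e) (proj1 (filterlim_locally _ _) him e)).
intros n [h1 h2]; rewrite hs; split; assumption.
Qed.

(** * Operators *)

(** An adjoint in this sense is unique and automatically linear and bounded, so
    quantifying it existentially below amounts to naming "the" adjoint. *)
Definition is_adjoint (A B : ell2 -> ell2) : Prop :=
  forall f g : ell2, ell2_inner (A f) g = ell2_inner f (B g).

Definition positive_operator (P : ell2 -> ell2) : Prop :=
  forall f : ell2, 0 <= Re (ell2_inner (P f) f) /\ Im (ell2_inner (P f) f) = 0.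

Definition posinormal (A : ell2 -> ell2) : Prop :=
  is_linear A /\
  exists A' : ell2 -> ell2, is_linear A' /\ is_adjoint A A' /\
  exists P : ell2 -> ell2, is_linear P /\ positive_operator P /\
    forall f : ell2, A (A' f) = A' (P (A f)).

Definition coposinormal (A : ell2 -> ell2) : Prop :=
  is_linear A /\
  exists A' : ell2 -> ell2, is_linear A' /\ is_adjoint A A' /\ posinormal A'.

Definition matrix_operator (m : nat -> nat -> C) (A : ell2 -> ell2) : Prop :=
  forall (f : ell2) (i : nat), is_series (fun j => (m i j * f j)%C) (A f i).

(** * Weighted mean matrices *)

Definition weighted_mean_matrix (w : nat -> R) (i j : nat) : C :=
  if (j <=? i)%nat then RtoC (w j / sum_n w i) else RtoC 0.

(* Main.v *)
(** Write [W_i] for the partial sums of the weights. By Douglas' factorization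
    idea it is enough to find a bounded [T] with [M T = M^*]. Formally
    [T = M^(-1) M^*], where [M^(-1)] is bidiagonal, and since
    [(M^* f)_n / w_n - (M^* f)_(n+1) / w_(n+1) = f_n / W_n], one gets
    [T = D M^* - E] with [D] diagonal with entries
    [(W_n w_n - W_(n-1) w_(n-1)) / w_n^2] and [E] the weighted shift with
    weights [w_(n-1) / w_n]. For affine [w] both are bounded, and [M] itself is
    bounded by Jensen's inequality in each row together with the telescoping
    estimate [1 / W_n <= K (1 / w_n - 1 / w_(n+1))]. *)

Require Import Defs.
From Stdlib Require Import Reals Lra Lia Arith.
From Coquelicot Require Import Coquelicot.
Open Scope R_scope.

(** * Partial sums of series, and operators given by coordinate formulas *)

Lemma is_series_truncated {K : AbsRing} {V : NormedModule K} (u : nat -> V) (N : nat) :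
  is_series (fun n => if (n <=? N)%nat then u n else zero) (sum_n u N).
Proof.
unfold is_series.
apply filterlim_ext_loc with (fun _ : nat => sum_n u N); [| apply filterlim_const].
exists N; intros n hn; induction hn as [| n hn IH].
- apply sum_n_ext_loc; intros k hk.
  now rewrite (proj2 (Nat.leb_le k N) hk).
- rewrite sum_Sn, <- IH.
  rewrite (proj2 (Nat.leb_gt (S n) N)) by lia.
  now rewrite plus_zero_r.
Qed.

Lemma sum_n_nonneg (u : nat -> R) (N : nat) :
  (forall n, 0 <= u n) -> 0 <= sum_n u N.
Proof. intros hu; rewrite sum_n_Reals; now apply cond_pos_sum. Qed.

Lemma sum_n_le_Series (u : nat -> R) (N : nat) :
  (forall n, 0 <= u n) -> ex_series u -> sum_n u N <= Series u.
Proof.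
intros hu hs.
apply (is_lim_seq_incr_compare (sum_n u)); [exact (Series_correct _ hs) |].
intros n; rewrite sum_Sn; unfold plus; simpl; specialize (hu (S n)); lra.
Qed.

Lemma ex_series_bounded (u : nat -> R) (B : R) :
  (forall n, 0 <= u n) -> (forall N, sum_n u N <= B) -> ex_series u.
Proof.
intros hu hB.
destruct (ex_finite_lim_seq_incr (sum_n u) B) as [l hl]; [| exact hB | now exists l].
intros n; rewrite sum_Sn; unfold plus; simpl; specialize (hu (S n)); lra.
Qed.

Lemma Series_le_bound (u : nat -> R) (B : R) :
  (forall n, 0 <= u n) -> (forall N, sum_n u N <= B) -> Series u <= B.
Proof.
intros hu hB.
assert (hs := Series_correct _ (ex_series_bounded u B hu hB)).
exact (is_lim_seq_le _ _ (Finite _) (Finite B) hB hs (is_lim_seq_const B)).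
Qed.

Lemma sum_n_Cmod_le_norm (f : ell2) (N : nat) :
  sum_n (fun n => Cmod (f n) ^ 2) N <= ell2_norm f ^ 2.
Proof.
rewrite ell2_norm_sqr; apply sum_n_le_Series; [intros n; apply pow2_ge_0 |].
apply ell2_summable.
Qed.

(** A single bound on finite sums does two jobs: it makes [L f] square-summable, so that it is a
    vector of [ell2], and it gives the operator norm bound [sqrt B]. All operators constructed below
    come from this criterion. *)
Lemma bounded_operator_exists (L : ell2 -> nat -> C) (B : R) :
  0 < B ->
  (forall f g n, L (ell2_plus f g) n = (L f n + L g n)%C) ->
  (forall c f n, L (ell2_scal c f) n = (c * L f n)%C) ->
  (forall f N, sum_n (fun n => Cmod (L f n) ^ 2) N <= B * ell2_norm f ^ 2) ->
  exists A : ell2 -> ell2, is_linear A /\ forall f n, A f n = L f n.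
Proof.
intros hB hplus hscal hbound.
assert (hpos : forall f n, 0 <= Cmod (L f n) ^ 2) by (intros; apply pow2_ge_0).
exists (fun f => mk_ell2 (L f) (ex_series_bounded _ _ (hpos f) (hbound f))).
split; [| reflexivity].
constructor.
- intros f g; apply ell2_eq; intros n; apply hplus.
- intros c f; apply ell2_eq; intros n; apply hscal.
- exists (sqrt B); split; [now apply sqrt_lt_R0 |].
  intros f.
  assert (hf := ell2_norm_ge0 f).
  change (ell2_norm (mk_ell2 (L f) (ex_series_bounded _ _ (hpos f) (hbound f)))
          <= sqrt B * ell2_norm f).
  rewrite <- (sqrt_pow2 _ hf) at 2.
  rewrite <- sqrt_mult_alt by lra.
  apply sqrt_le_1_alt; simpl ell2_seq.
  exact (Series_le_bound _ _ (hpos f) (hbound f)).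
Qed.

(** * Inner product and the Cauchy-Schwarz inequality *)

Lemma ell2_inner_unique (f g : ell2) (l : C) :
  is_series (fun n => (f n * Cconj (g n))%C) l -> ell2_inner f g = l.
Proof.
intros h; exact (filterlim_locally_unique _ _ _ (ell2_inner_correct f g) h).
Qed.

Lemma ell2_inner_plus_l (f g h : ell2) :
  ell2_inner (ell2_plus f g) h = (ell2_inner f h + ell2_inner g h)%C.
Proof.
apply ell2_inner_unique.
apply is_series_ext with (fun n => plus (f n * Cconj (h n))%C (g n * Cconj (h n))%C).
- intros n; simpl; change plus with Cplus; ring.
- exact (is_series_plus _ _ _ _ (ell2_inner_correct f h) (ell2_inner_correct g h)).
Qed.

Lemma ell2_inner_scal_l (c : C) (f h : ell2) :
  ell2_inner (ell2_scal c f) h = (c * ell2_inner f h)%C.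
Proof.
apply ell2_inner_unique.
apply is_series_ext with (fun n => scal c (f n * Cconj (h n))%C).
- intros n; simpl; change scal with Cmult; ring.
- exact (is_series_scal c _ _ (ell2_inner_correct f h)).
Qed.

Lemma ell2_inner_sym (f g : ell2) : ell2_inner g f = Cconj (ell2_inner f g).
Proof.
unfold ell2_inner, Cconj; simpl; f_equal.
- apply Series_ext; intros n; simpl; ring.
- rewrite <- Series_opp; apply Series_ext; intros n; simpl; ring.
Qed.

Lemma ell2_inner_self (f : ell2) : ell2_inner f f = RtoC (ell2_norm f ^ 2).
Proof.
rewrite ell2_norm_sqr; unfold ell2_inner, RtoC; f_equal.
- apply Series_ext; intros n; rewrite <- Cmod2_conj; reflexivity.
(* The zero terms are written as [0 * 0] so that [Series_scal_l] can pull a factor [0] out of the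
   series. *)
- rewrite (Series_ext _ (fun n => 0 * 0)); [rewrite Series_scal_l; ring |].
  intros n; rewrite <- Cmod2_conj; simpl; ring.
Qed.

Lemma sum_n_cauchy_schwarz (p q : nat -> R) (N : nat) :
  sum_n (fun n => p n * q n) N ^ 2
    <= sum_n (fun n => p n ^ 2) N * sum_n (fun n => q n ^ 2) N.
Proof.
induction N as [| N IH].
- rewrite !sum_O; right; ring.
- rewrite !sum_Sn; change plus with Rplus.
  assert (hP := sum_n_nonneg (fun n => p n ^ 2) N (fun n => pow2_ge_0 _)).
  assert (hQ := sum_n_nonneg (fun n => q n ^ 2) N (fun n => pow2_ge_0 _)).
  revert IH hP hQ.
  generalize (sum_n (fun n => p n * q n) N) (sum_n (fun n => p n ^ 2) N)
    (sum_n (fun n => q n ^ 2) N) (p (S N)) (q (S N)).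
  intros s P Q x y hs hP hQ.
  (* The cross term of the expanded square. After squaring, the claim follows from [s^2 <= P Q] and
     [(P y^2 - Q x^2)^2 >= 0]. *)
  assert (hxy : Rabs (2 * s * x * y) <= Rabs (P * y ^ 2 + Q * x ^ 2)).
  { apply Rsqr_le_abs_0; rewrite !Rsqr_pow2.
    assert (h1 := pow2_ge_0 (P * y ^ 2 - Q * x ^ 2)).
    assert (h2 := Rmult_le_compat_r ((x * y) ^ 2) _ _ (pow2_ge_0 _) hs).
    nra. }
  rewrite (Rabs_pos_eq (P * y ^ 2 + Q * x ^ 2)) in hxy by nra.
  assert (h := Rle_abs (2 * s * x * y)).
  nra.
Qed.

Lemma sum_n_Cmod_le (u : nat -> C) (N : nat) :
  Cmod (sum_n u N) <= sum_n (fun n => Cmod (u n)) N.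
Proof.
exact (norm_sum_n_m (K := C_AbsRing) (V := C_NormedModule) u 0 N).
Qed.

(** The finite inequality bounds the modulus of every partial sum by the product of the norms, and
    continuity of the modulus carries the bound to the limit. *)
Lemma ell2_cauchy_schwarz (f g : ell2) :
  Cmod (ell2_inner f g) <= ell2_norm f * ell2_norm g.
Proof.
assert (hf := ell2_norm_ge0 f). assert (hg := ell2_norm_ge0 g).
assert (hlim := filterlim_comp _ _ _ _ _ _ _ _ (ell2_inner_correct f g)
  (filterlim_norm (K := C_AbsRing) (V := C_NormedModule) (ell2_inner f g))).
apply (is_lim_seq_le (fun N => Cmod (sum_n (fun n => (f n * Cconj (g n))%C) N))
  (fun _ => ell2_norm f * ell2_norm g) (Finite (Cmod (ell2_inner f g)))
  (Finite (ell2_norm f * ell2_norm g)));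
  [| exact hlim | apply is_lim_seq_const].
intros N.
apply Rle_trans with (1 := sum_n_Cmod_le _ _).
apply Rsqr_incr_0_var; [rewrite !Rsqr_pow2 | nra].
rewrite (sum_n_ext _ (fun n => Cmod (f n) * Cmod (g n)))
  by (intros n; now rewrite Cmod_mult, Cmod_conj).
apply Rle_trans with (1 := sum_n_cauchy_schwarz _ _ _).
rewrite Rpow_mult_distr.
apply Rmult_le_compat; try apply sum_n_Cmod_le_norm;
  apply sum_n_nonneg; intros n; apply pow2_ge_0.
Qed.

(** * Standard basis and approximation by finite combinations *)

Lemma ell2_basis_summable (j : nat) :
  ex_series (fun n => Cmod (if (n =? j)%nat then RtoC 1 else RtoC 0) ^ 2).
Proof.
exists (sum_n (fun n => Cmod (if (n =? j)%nat then RtoC 1 else RtoC 0) ^ 2) j).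
refine (is_series_ext _ _ _ _ (is_series_truncated (V := R_NormedModule) _ j)).
intros n; simpl.
destruct (Nat.leb_spec n j) as [h | h]; [reflexivity |].
rewrite (proj2 (Nat.eqb_neq n j)) by lia.
rewrite Cmod_0; change zero with 0; ring.
Qed.

Definition ell2_basis (j : nat) : ell2 :=
  mk_ell2 (fun n => if (n =? j)%nat then RtoC 1 else RtoC 0) (ell2_basis_summable j).

Definition ell2_combination (c : nat -> C) (N : nat) : ell2 :=
  sum_n (fun j => ell2_scal (c j) (ell2_basis j)) N.

Lemma ell2_combination_S (c : nat -> C) (N : nat) :
  ell2_combination c (S N)
  = ell2_plus (ell2_combination c N) (ell2_scal (c (S N)) (ell2_basis (S N))).
Proof. exact (sum_Sn _ _). Qed.

Lemma ell2_combination_coord (c : nat -> C) (N n : nat) :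
  ell2_combination c N n = if (n <=? N)%nat then c n else RtoC 0.
Proof.
induction N as [| N IH].
- unfold ell2_combination; rewrite sum_O; simpl.
  destruct n; simpl; ring.
- rewrite ell2_combination_S.
  change ((ell2_combination c N n
    + c (S N) * (if (n =? S N)%nat then RtoC 1 else RtoC 0))%C
    = if (n <=? S N)%nat then c n else RtoC 0).
  rewrite IH.
  destruct (Nat.leb_spec n N), (Nat.leb_spec n (S N)), (Nat.eqb_spec n (S N));
    try lia; subst; ring.
Qed.

Lemma ell2_combination_norm (c : nat -> C) (N : nat) :
  ell2_norm (ell2_combination c N) ^ 2 = sum_n (fun n => Cmod (c n) ^ 2) N.
Proof.
rewrite ell2_norm_sqr; apply is_series_unique.
refine (is_series_ext _ _ _ _ (is_series_truncated (V := R_NormedModule) _ N)).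
intros n; rewrite ell2_combination_coord; simpl.
destruct (n <=? N)%nat; [reflexivity |].
rewrite Cmod_0; change zero with 0; ring.
Qed.

Lemma ell2_inner_basis_r (f : ell2) (j : nat) : ell2_inner f (ell2_basis j) = f j.
Proof.
apply ell2_inner_unique.
replace (f j) with (sum_n (fun n => (f n * Cconj (ell2_basis j n))%C) j).
- refine (is_series_ext _ _ _ _ (is_series_truncated (V := C_NormedModule) _ j)).
  intros n; simpl.
  destruct (Nat.leb_spec n j) as [h | h]; [reflexivity |].
  rewrite (proj2 (Nat.eqb_neq n j)) by lia.
  change zero with (RtoC 0); unfold Cconj; simpl; apply injective_projections; simpl; ring.
- destruct j as [| j].
  + rewrite sum_O; apply injective_projections; simpl; ring.
  + rewrite sum_Sn, (sum_n_ext_loc _ (fun _ => RtoC 0)).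
    * replace (sum_n (fun _ : nat => RtoC 0) j) with (RtoC 0).
      -- apply injective_projections; simpl; rewrite Nat.eqb_refl; simpl; ring.
      -- symmetry; induction j as [| j IH]; [now rewrite sum_O |].
         rewrite sum_Sn, IH; apply (plus_zero_r (G := C_AbelianGroup)).
    * intros n hn; simpl; rewrite (proj2 (Nat.eqb_neq n (S j))) by lia.
      apply injective_projections; simpl; ring.
Qed.

Lemma ell2_inner_nondegenerate (f g : ell2) :
  (forall h, ell2_inner f h = ell2_inner g h) -> f = g.
Proof.
intros h; apply ell2_eq; intros n.
now rewrite <- !ell2_inner_basis_r.
Qed.

(** The remainder keeps exactly the coordinates beyond [N], so its squared norm is the tail
    [l - sum_n (fun n => Cmod (f n) ^ 2) N], which tends to [0]. *)
Lemma ell2_combination_converges (f : ell2) :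
  is_lim_seq (fun N => ell2_norm (minus f (ell2_combination f N))) 0.
Proof.
set (l := Series (fun n => Cmod (f n) ^ 2)).
apply is_lim_seq_ext with
  (fun N => sqrt (l - sum_n (fun n => Cmod (f n) ^ 2) N)).
- intros N; unfold l.
  assert (ht := is_series_truncated (V := R_NormedModule)
    (fun n => Cmod (f n) ^ 2) N).
  replace (sum_n (fun n => Cmod (f n) ^ 2) N)
    with (Series (fun n => if (n <=? N)%nat then Cmod (f n) ^ 2 else zero))
    by exact (is_series_unique _ _ ht).
  rewrite <- Series_minus; [| apply ell2_summable | eexists; exact ht].
  unfold ell2_norm; f_equal; apply Series_ext; intros n.
  change (minus f (ell2_combination f N) n)
    with (f n + RtoC (-1) * ell2_combination f N n)%C.
  rewrite ell2_combination_coord; destruct (n <=? N)%nat.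
  + replace (f n + RtoC (-1) * f n)%C with (RtoC 0) by ring.
    rewrite Cmod_0; ring.
  + replace (f n + RtoC (-1) * RtoC 0)%C with (f n) by ring.
    change zero with 0; ring.
- replace 0 with (sqrt (l - l)) by (rewrite Rminus_diag; apply sqrt_0).
  apply is_lim_seq_continuous; [apply continuity_pt_sqrt; lra |].
  apply is_lim_seq_minus'; [apply is_lim_seq_const |].
  exact (Series_correct _ (ell2_summable f)).
Qed.

(** * Adjoints and Douglas factorization *)

Lemma is_adjoint_sym (A B : ell2 -> ell2) : is_adjoint A B -> is_adjoint B A.
Proof.
intros h f g.
now rewrite ell2_inner_sym, (ell2_inner_sym (A g)), h.
Qed.

Lemma Cmod_le_zero (z : C) : Cmod z <= 0 -> z = RtoC 0.
Proof. intros h; apply Cmod_eq_0; assert (h' := Cmod_ge_0 z); lra. Qed.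

Lemma ell2_inner_combination_l (A : ell2 -> ell2) (g : ell2) (c : nat -> C) (N : nat) :
  is_linear A ->
  ell2_inner (A (ell2_combination c N)) g
  = sum_n (fun j => (c j * ell2_inner (A (ell2_basis j)) g)%C) N.
Proof.
intros hA.
assert (hscal : forall j, ell2_inner (A (ell2_scal (c j) (ell2_basis j))) g
                          = (c j * ell2_inner (A (ell2_basis j)) g)%C).
{ intros j; rewrite <- ell2_inner_scal_l; f_equal.
  exact (linear_scal A hA (c j) (ell2_basis j)). }
induction N as [| N IH].
- rewrite sum_O; unfold ell2_combination; rewrite sum_O; apply hscal.
- rewrite sum_Sn, <- IH, <- hscal, ell2_combination_S.
  change plus with Cplus.
  rewrite <- ell2_inner_plus_l; f_equal.
  exact (linear_plus A hA (ell2_combination c N) _).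
Qed.

(** The difference [D] of the two sides is additive and vanishes on finite combinations of basis
    vectors, so [D f = D r] for the remainder [r] of [f]. By Cauchy-Schwarz [D r] is at most [K]
    times the norm of [r], which tends to [0]. With [B] the identity, this checks an adjoint
    relation on basis vectors only. *)
Lemma ell2_linear_eq_of_basis (A B : ell2 -> ell2) (g h : ell2) :
  is_linear A -> is_linear B ->
  (forall j, ell2_inner (A (ell2_basis j)) g = ell2_inner (B (ell2_basis j)) h) ->
  forall f, ell2_inner (A f) g = ell2_inner (B f) h.
Proof.
intros hA hB hbasis f.
destruct (linear_norm A hA) as [a [ha hAn]].
destruct (linear_norm B hB) as [b [hb hBn]].
set (D := fun u => (ell2_inner (A u) g - ell2_inner (B u) h)%C).
enough (hD : Cmod (D f) <= 0).
{ apply Cmod_le_zero in hD; unfold D in hD.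
  replace (ell2_inner (A f) g) with (RtoC 0 + ell2_inner (B f) h)%C; [ring |].
  rewrite <- hD; ring. }
set (K := a * ell2_norm g + b * ell2_norm h).
assert (hlim : is_lim_seq
  (fun N => K * ell2_norm (minus f (ell2_combination f N))) (K * 0)).
{ apply (is_lim_seq_scal_l _ K (Finite 0)), ell2_combination_converges. }
rewrite Rmult_0_r in hlim.
refine (is_lim_seq_le (fun _ => Cmod (D f)) _ (Finite _) (Finite 0) _
  (is_lim_seq_const _) hlim).
intros N.
set (u := ell2_combination f N); set (r := minus f u).
assert (hf : f = plus r u).
{ unfold r, minus; now rewrite <- plus_assoc, plus_opp_l, plus_zero_r. }
replace (D f) with (D r).
- unfold D, K.
  apply Rle_trans with (1 := Cmod_triangle _ _); rewrite Cmod_opp.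
  assert (h1 := ell2_cauchy_schwarz (A r) g).
  assert (h2 := ell2_cauchy_schwarz (B r) h).
  assert (h3 := Rmult_le_compat_r _ _ _ (ell2_norm_ge0 g) (hAn r)).
  assert (h4 := Rmult_le_compat_r _ _ _ (ell2_norm_ge0 h) (hBn r)).
  change (@norm C_AbsRing ell2_NormedModule) with ell2_norm in *.
  lra.
- rewrite hf at 1; unfold D.
  rewrite (linear_plus A hA), (linear_plus B hB).
  change (@plus ell2_NormedModule) with ell2_plus; rewrite !ell2_inner_plus_l.
  replace (ell2_inner (A u) g) with (ell2_inner (B u) h); [ring |].
  unfold u; rewrite !ell2_inner_combination_l by assumption.
  apply sum_n_ext; intros j; now rewrite hbasis.
Qed.

(** The coordinates of an adjoint are forced: [(B g)_j = <B g, e_j> = <g, A e_j>]. Taking them as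
    the definition, linearity is immediate and the work lies in the norm bound. *)
Lemma adjoint_exists (A : ell2 -> ell2) :
  is_linear A -> exists B, is_linear B /\ is_adjoint A B.
Proof.
intros hA; destruct (linear_norm A hA) as [a [ha hAn]].
change (@norm C_AbsRing ell2_NormedModule) with ell2_norm in hAn.
destruct (bounded_operator_exists (fun g j => ell2_inner g (A (ell2_basis j))) (a ^ 2))
  as [B [hB hBE]].
- now apply pow_lt.
- intros; apply ell2_inner_plus_l.
- intros; apply ell2_inner_scal_l.
- intros g N.
  set (c := fun j => ell2_inner g (A (ell2_basis j))).
  (* Testing against [u = sum_j c_j e_j] gives [s = <A u, g>], while [|u|^2 = s]. *)
  set (s := sum_n (fun n => Cmod (c n) ^ 2) N : R).
  set (u := ell2_combination c N).
  assert (hu : ell2_norm u ^ 2 = s) by apply ell2_combination_norm.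
  assert (hs : ell2_inner (A u) g = RtoC s).
  { unfold u, s; rewrite ell2_inner_combination_l by assumption.
    clear; induction N as [| N IH].
    - rewrite !sum_O, Cmod2_conj; unfold c; now rewrite (ell2_inner_sym g).
    - rewrite !sum_Sn, IH.
      change (@plus C_AbelianMonoid) with Cplus.
      change (@plus R_AbelianMonoid) with Rplus.
      rewrite RtoC_plus, Cmod2_conj; unfold c; now rewrite (ell2_inner_sym g). }
  assert (hcs := ell2_cauchy_schwarz (A u) g).
  rewrite hs, Cmod_R in hcs.
  assert (hle := Rle_abs s).
  assert (hn := Rmult_le_compat_r _ _ _ (ell2_norm_ge0 g) (hAn u)).
  assert (h0 := ell2_norm_ge0 u). assert (hg := ell2_norm_ge0 g).
  change (s <= a ^ 2 * ell2_norm g ^ 2).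
  (* From [s <= a |u| |g|] and [2 a |u| |g| <= |u|^2 + a^2 |g|^2 = s + a^2 |g|^2] the bound follows
     without dividing by [|u|], which may be zero. *)
  assert (hsq := pow2_ge_0 (ell2_norm u - a * ell2_norm g)).
  nra.
- exists B; split; [assumption |]; intros f g.
  change (ell2_inner (A f) g = ell2_inner ((fun x => x) f) (B g)).
  apply ell2_linear_eq_of_basis; [assumption | apply is_linear_id |].
  intros j; rewrite (ell2_inner_sym (B g)), ell2_inner_basis_r, hBE.
  apply ell2_inner_sym.
Qed.

(* Douglas' factorization: [A' = A T] makes [P = T T^*] an interrupter of [A'],
   since [A' A = A T T^* A'] once [T^* A' = A] is known. *)
Lemma coposinormal_of_factorization (A A' T : ell2 -> ell2) :
  is_linear A -> is_linear A' -> is_linear T -> is_adjoint A A' ->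
  (forall f, A (T f) = A' f) -> coposinormal A.
Proof.
intros hA hA' hT hadj hfact.
destruct (adjoint_exists T hT) as [Ts [hTs hTadj]].
split; [assumption |].
exists A'; split; [assumption |]; split; [assumption |].
split; [assumption |].
exists A; split; [assumption |]; split; [now apply is_adjoint_sym |].
exists (fun f => T (Ts f)); split; [now apply (is_linear_comp Ts T) |]; split.
- intros f; rewrite hTadj, ell2_inner_self; simpl.
  split; [assert (h := pow2_ge_0 (ell2_norm (Ts f))); simpl in h; exact h | reflexivity].
- intros f; rewrite hfact; f_equal.
  apply ell2_inner_nondegenerate; intros g.
  rewrite (is_adjoint_sym _ _ hTadj), (is_adjoint_sym _ _ hadj), hfact.
  apply hadj.
Qed.

(** * Weighted means: boundedness, adjoint and the factor [T] *)

Definition weighted_mean (w : nat -> R) (f : nat -> C) (i : nat) : C :=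
  (RtoC (/ sum_n w i) * sum_n (fun j => RtoC (w j) * f j)%C i)%C.

Lemma weighted_mean_is_series (w : nat -> R) (f : nat -> C) (i : nat) :
  is_series (fun j => (weighted_mean_matrix w i j * f j)%C) (weighted_mean w f i).
Proof.
apply (is_series_ext (V := C_NormedModule)) with (fun j => scal (RtoC (/ sum_n w i))
  (if (j <=? i)%nat then (RtoC (w j) * f j)%C else zero)).
- intros j; unfold weighted_mean_matrix.
  change (Cmult (RtoC (/ sum_n w i))
      (if (j <=? i)%nat then (RtoC (w j) * f j)%C else RtoC 0)
    = ((if (j <=? i)%nat then RtoC (w j / sum_n w i) else RtoC 0) * f j)%C).
  destruct (j <=? i)%nat.
  + unfold Rdiv; rewrite RtoC_mult; ring.
  + ring.
- exact (is_series_scal (V := C_NormedModule) _ _ _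
    (is_series_truncated (V := C_NormedModule) _ i)).
Qed.

Lemma sum_n_pos (w : nat -> R) (i : nat) : (forall n, 0 < w n) -> 0 < sum_n w i.
Proof.
intros hw; induction i as [| i IH]; [rewrite sum_O; apply hw |].
rewrite sum_Sn; change plus with Rplus; specialize (hw (S i)); lra.
Qed.

(** Cauchy-Schwarz for the sequences [sqrt w] and [sqrt w * x]. *)
Lemma sum_n_weighted_jensen (w x : nat -> R) (N : nat) :
  (forall n, 0 < w n) ->
  sum_n (fun n => w n * x n) N ^ 2 <= sum_n w N * sum_n (fun n => w n * x n ^ 2) N.
Proof.
intros hw.
assert (h := sum_n_cauchy_schwarz (fun n => sqrt (w n)) (fun n => sqrt (w n) * x n) N).
assert (hsq : forall n, sqrt (w n) ^ 2 = w n)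
  by (intros n; apply pow2_sqrt; left; apply hw).
rewrite (sum_n_ext (fun n => sqrt (w n) * (sqrt (w n) * x n)) (fun n => w n * x n)),
  (sum_n_ext (fun n => (sqrt (w n) * x n) ^ 2) (fun n => w n * x n ^ 2)),
  (sum_n_ext (fun n => sqrt (w n) ^ 2) w) in h; [exact h | exact hsq | |].
- intros n; now rewrite Rpow_mult_distr, hsq.
- intros n; rewrite <- (hsq n) at 3; simpl; ring.
Qed.

(** After exchanging the sums, [x_j] carries the coefficient [w_j] times a sum of [1 / W_i] over
    [i >= j]; the hypothesis makes that sum telescope to at most [K / w_j]. *)
Lemma sum_n_weighted_means_le (w x : nat -> R) (K : R) :
  (forall n, 0 < w n) -> (forall n, 0 <= x n) -> 0 < K ->
  (forall n, / sum_n w n <= K * (/ w n - / w (S n))) ->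
  forall N, sum_n (fun i => / sum_n w i * sum_n (fun j => w j * x j) i) N
    <= K * sum_n x N.
Proof.
intros hw hx hK hKw N.
set (s := sum_n (fun j => w j * x j)).
assert (hs : forall n, 0 <= s n).
{ intros n; apply sum_n_nonneg; intros j; apply Rmult_le_pos; [left |]; auto. }
assert (hstep : forall n, / sum_n w n * s n <= K * (/ w n - / w (S n)) * s n).
{ intros n; apply Rmult_le_compat_r; auto. }
(* Strengthening for the induction: the subtracted term is the endpoint of the telescoping sums, and
   being nonnegative it is dropped afterwards. *)
apply Rle_trans with (K * (sum_n x N - s N / w (S N))).
- induction N as [| N IH].
  + rewrite (sum_O x), sum_O; apply Rle_trans with (1 := hstep 0%nat).
    unfold s; rewrite sum_O; right; field; split; apply Rgt_not_eq, hw.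
  + rewrite (sum_Sn _ N), (sum_Sn x N); change plus with Rplus.
    specialize (hstep (S N)).
    assert (hsN : s (S N) = s N + w (S N) * x (S N)) by exact (sum_Sn _ _).
    replace (K * (sum_n x N + x (S N) - s (S N) / w (S (S N))))
      with (K * (sum_n x N - s N / w (S N)) + K * (/ w (S N) - / w (S (S N))) * s (S N)).
    * now apply Rplus_le_compat.
    * rewrite hsN; field; split; apply Rgt_not_eq, hw.
- apply Rmult_le_compat_l; [lra |].
  assert (0 <= s N / w (S N)); [| lra].
  apply Rmult_le_pos; [auto | left; apply Rinv_0_lt_compat, hw].
Qed.

Lemma weighted_mean_Cmod_sqr_le (w : nat -> R) (f : nat -> C) (i : nat) :
  (forall n, 0 < w n) ->
  Cmod (weighted_mean w f i) ^ 2
    <= / sum_n w i * sum_n (fun j => w j * Cmod (f j) ^ 2) i.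
Proof.
intros hw; assert (hW := sum_n_pos w i hw).
unfold weighted_mean; rewrite Cmod_mult, Cmod_R, Rpow_mult_distr.
assert (hi := Rinv_0_lt_compat _ hW).
rewrite Rabs_pos_eq by lra.
replace (/ sum_n w i * sum_n (fun j => w j * Cmod (f j) ^ 2) i)
  with ((/ sum_n w i) ^ 2 * (sum_n w i * sum_n (fun j => w j * Cmod (f j) ^ 2) i))
  by (field; lra).
apply Rmult_le_compat_l; [apply pow2_ge_0 |].
apply Rle_trans with (2 := sum_n_weighted_jensen w (fun j => Cmod (f j)) i hw).
apply pow_incr; split; [apply Cmod_ge_0 |].
apply Rle_trans with (1 := sum_n_Cmod_le _ _); right.
apply sum_n_ext; intros j; rewrite Cmod_mult, Cmod_R, Rabs_pos_eq; [reflexivity |].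
left; apply hw.
Qed.

Lemma weighted_mean_operator_exists (w : nat -> R) (K : R) :
  (forall n, 0 < w n) -> 0 < K ->
  (forall n, / sum_n w n <= K * (/ w n - / w (S n))) ->
  exists M : ell2 -> ell2, is_linear M /\ forall f n, M f n = weighted_mean w f n.
Proof.
intros hw hK hKw.
apply (bounded_operator_exists (fun f => weighted_mean w f) K hK).
- intros f g n; unfold weighted_mean; rewrite <- Cmult_plus_distr_l; f_equal.
  transitivity (sum_n (fun j => plus (RtoC (w j) * f j)%C (RtoC (w j) * g j)%C) n).
  + apply sum_n_ext; intros j; apply Cmult_plus_distr_l.
  + exact (sum_n_plus _ _ _).
- intros c f n; unfold weighted_mean.
  transitivity (RtoC (/ sum_n w n) * (c * sum_n (fun j => RtoC (w j) * f j) n))%C; [| ring].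
  f_equal.
  transitivity (sum_n (fun j => mult c (RtoC (w j) * f j)%C) n).
  + apply sum_n_ext; intros j; simpl; change mult with Cmult; ring.
  + exact (sum_n_mult_l (K := C_Ring) c _ n).
- intros f N.
  apply Rle_trans with
    (sum_n (fun i => / sum_n w i * sum_n (fun j => w j * Cmod (f j) ^ 2) i) N).
  + rewrite !sum_n_Reals; apply sum_Rle; intros n _.
    now apply weighted_mean_Cmod_sqr_le.
  + apply Rle_trans with (K * sum_n (fun n => Cmod (f n) ^ 2) N).
    * apply sum_n_weighted_means_le; try assumption; intros n; apply pow2_ge_0.
    * apply Rmult_le_compat_l; [lra | apply sum_n_Cmod_le_norm].
Qed.

(* [M e_j / w_j] and [M e_(j+1) / w_(j+1)] are the tails of [1 / W_i] from [j]
   and from [j + 1] on, so they differ by [e_j / W_j]. *)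
Lemma weighted_mean_adjoint_step (w : nat -> R) (M M' : ell2 -> ell2) (f : ell2) (j : nat) :
  (forall n, 0 < w n) -> is_adjoint M M' ->
  (forall g n, M g n = weighted_mean w g n) ->
  f j = (RtoC (sum_n w j)
         * (RtoC (/ w j) * M' f j - RtoC (/ w (S j)) * M' f (S j)))%C.
Proof.
intros hw hadj hM.
assert (hW := sum_n_pos w j hw).
assert (hcol : forall k i, M (ell2_basis k) i
  = if (k <=? i)%nat then RtoC (w k * / sum_n w i) else RtoC 0).
{ intros k i; rewrite hM; unfold weighted_mean.
  rewrite (sum_n_ext _ (fun n => if (n =? k)%nat then RtoC (w k) else RtoC 0)).
  2:{ intros n; simpl; destruct (Nat.eqb_spec n k); subst; ring. }
  replace (sum_n (fun n => if (n =? k)%nat then RtoC (w k) else RtoC 0) i)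
    with (if (k <=? i)%nat then RtoC (w k) else RtoC 0).
  { destruct (k <=? i)%nat; rewrite ?RtoC_mult; ring. }
  induction i as [| i IH].
  - rewrite sum_O; destruct k; reflexivity.
  - rewrite sum_Sn, <- IH; change plus with Cplus.
    destruct (Nat.leb_spec k i), (Nat.leb_spec k (S i)), (Nat.eqb_spec (S i) k);
      try lia; ring. }
assert (hcoord : forall k, M' f k = ell2_inner f (M (ell2_basis k))).
{ intros k; rewrite <- ell2_inner_basis_r; exact (is_adjoint_sym _ _ hadj _ _). }
rewrite !hcoord.
assert (he : ell2_basis j = ell2_scal (RtoC (sum_n w j))
  (ell2_plus (ell2_scal (RtoC (/ w j)) (M (ell2_basis j)))
     (ell2_scal (RtoC (- / w (S j))) (M (ell2_basis (S j)))))).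
{ apply ell2_eq; intros i.
  change ((if (i =? j)%nat then RtoC 1 else RtoC 0)
    = (RtoC (sum_n w j) * (RtoC (/ w j) * M (ell2_basis j) i
        + RtoC (- / w (S j)) * M (ell2_basis (S j)) i))%C).
  rewrite !hcol.
  assert (h1 := hw j). assert (h2 := hw (S j)). assert (h3 := sum_n_pos w i hw).
  destruct (Nat.leb_spec j i), (Nat.leb_spec (S j) i), (Nat.eqb_spec i j);
    try lia; subst; rewrite <- ?RtoC_mult, <- ?RtoC_plus, <- ?RtoC_mult; f_equal;
    field; lra. }
(* Pairing [f] with [he] gives the claim; the coefficients are real, so conjugating them changes
   nothing. *)
rewrite <- ell2_inner_basis_r at 1; rewrite he at 1.
rewrite ell2_inner_sym, ell2_inner_scal_l, ell2_inner_plus_l, !ell2_inner_scal_l.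
rewrite !Cmult_conj, Cplus_conj, !Cmult_conj, <- !ell2_inner_sym.
rewrite RtoC_opp.
apply injective_projections; simpl; ring.
Qed.

(* The operators [D] and [D M^* - E], with [M'] in the role of [M^* ]. *)
Definition adjoint_quotient_diag (w : nat -> R) (n : nat) : R :=
  match n with
  | O => 1
  | S k => (sum_n w (S k) * w (S k) - sum_n w k * w k) / w (S k) ^ 2
  end.

Definition adjoint_quotient (w : nat -> R) (M' : ell2 -> ell2) (f : ell2) (n : nat) : C :=
  (RtoC (adjoint_quotient_diag w n) * M' f n
   + match n with O => RtoC 0 | S k => RtoC (- (w k / w (S k))) * f k end)%C.

(** The sums of [w_j (T f)_j] telescope to [W_n (M' f)_n]: once [f_(n-1)] is expressed through
    [M' f] by [weighted_mean_adjoint_step], the terms with [W_(n-1) w_(n-1) / w_n] cancel and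
    [w_n (T f)_n] is the increment. *)
Lemma weighted_mean_adjoint_quotient (w : nat -> R) (M M' : ell2 -> ell2) (f : ell2) (n : nat) :
  (forall n, 0 < w n) -> is_adjoint M M' ->
  (forall g n, M g n = weighted_mean w g n) ->
  weighted_mean w (adjoint_quotient w M' f) n = M' f n.
Proof.
intros hw hadj hM; unfold weighted_mean.
replace (sum_n (fun j => RtoC (w j) * adjoint_quotient w M' f j)%C n)
  with (RtoC (sum_n w n) * M' f n)%C.
- assert (hW := sum_n_pos w n hw).
  rewrite Cmult_assoc, <- RtoC_mult, Rinv_l by lra; ring.
- induction n as [| n IH].
  (* The entry [1] at index [0] is the general formula with [W_(-1) = 0], since [W_0 = w_0]. *)
  + rewrite !sum_O; unfold adjoint_quotient, adjoint_quotient_diag.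
    apply injective_projections; simpl; ring.
  + rewrite (sum_Sn (fun j => RtoC (w j) * adjoint_quotient w M' f j)%C), <- IH.
    change (@plus C_AbelianMonoid) with Cplus; unfold adjoint_quotient at 1.
    rewrite (weighted_mean_adjoint_step w M M' f n hw hadj hM).
    assert (h1 := hw n). assert (h2 := hw (S n)).
    unfold adjoint_quotient_diag.
    generalize (sum_n w (S n)) (sum_n w n); intros W1 W0.
    apply injective_projections; simpl; field; lra.
Qed.

Lemma adjoint_quotient_operator_exists (w : nat -> R) (M' : ell2 -> ell2) (c : R) :
  (forall n, 0 < w n) -> is_linear M' ->
  (forall n, Rabs (adjoint_quotient_diag w n) <= c) ->
  (forall n, w n <= c * w (S n)) ->
  exists T : ell2 -> ell2, is_linear T /\ forall f n, T f n = adjoint_quotient w M' f n.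
Proof.
intros hw hM' hd hr.
destruct (linear_norm M' hM') as [m [hm hMn]].
change (@norm C_AbsRing ell2_NormedModule) with ell2_norm in hMn.
assert (hc : 0 < c).
{ assert (h := hr 0%nat). assert (h1 := hw 0%nat). assert (h2 := hw 1%nat). nra. }
(* The [2] comes from splitting the square of a sum, [c ^ 2] bounds the squared diagonal entries and
   shift weights alike, and [m ^ 2] and [1] account for [M'] and for the shift. *)
apply (bounded_operator_exists (adjoint_quotient w M') (2 * c ^ 2 * (m ^ 2 + 1))).
- assert (h := pow2_ge_0 m). assert (h' := pow_lt c 2 hc). nra.
- intros f g n; unfold adjoint_quotient.
  change (ell2_plus f g) with (@plus ell2_NormedModule f g).
  rewrite (linear_plus M' hM'); destruct n; simpl; ring.
- intros z f n; unfold adjoint_quotient.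
  change (ell2_scal z f) with (@scal C_Ring ell2_NormedModule z f).
  rewrite (linear_scal M' hM'); destruct n; simpl; ring.
- intros f N.
  set (r := fun n => match n with O => 0 | S k => Cmod (f k) ^ 2 end).
  assert (hterm : forall n, Cmod (adjoint_quotient w M' f n) ^ 2
    <= 2 * c ^ 2 * (Cmod (M' f n) ^ 2 + r n)).
  { intros n; unfold adjoint_quotient.
    apply Rle_trans with (1 := Cmod_sqr_plus_le 1 _ _ Rlt_0_1).
    rewrite Rinv_1.
    assert (h1 : Cmod (RtoC (adjoint_quotient_diag w n) * M' f n) ^ 2
                 <= c ^ 2 * Cmod (M' f n) ^ 2).
    { rewrite Cmod_mult, Cmod_R, Rpow_mult_distr.
      apply Rmult_le_compat_r; [apply pow2_ge_0 |].
      apply pow_incr; split; [apply Rabs_pos | apply hd]. }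
    enough (h2 : Cmod (match n with
                 | O => RtoC 0 | S k => RtoC (- (w k / w (S k))) * f k end)%C ^ 2
                 <= c ^ 2 * r n) by lra.
    destruct n as [| k]; simpl r.
    - rewrite Cmod_0; simpl; lra.
    - rewrite Cmod_mult, Cmod_R, Rpow_mult_distr, Rabs_Ropp.
      apply Rmult_le_compat_r; [apply pow2_ge_0 |].
      apply pow_incr; split; [apply Rabs_pos |].
      assert (hq : 0 < w k / w (S k)) by (apply Rdiv_lt_0_compat; apply hw).
      rewrite Rabs_pos_eq by lra.
      apply Rle_div_l; [apply hw | apply hr]. }
  apply Rle_trans with (sum_n (fun n => 2 * c ^ 2 * (Cmod (M' f n) ^ 2 + r n)) N).
  { rewrite !sum_n_Reals; apply sum_Rle; intros n _; apply hterm. }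
  replace (sum_n (fun n => 2 * c ^ 2 * (Cmod (M' f n) ^ 2 + r n)) N)
    with (2 * c ^ 2 * (sum_n (fun n => Cmod (M' f n) ^ 2) N + sum_n r N)).
  2:{ symmetry; etransitivity; [exact (sum_n_mult_l (K := R_Ring) _ _ _) |].
      apply (f_equal (Rmult _)); exact (sum_n_plus _ _ _). }
  rewrite (Rmult_assoc (2 * c ^ 2)).
  apply Rmult_le_compat_l; [assert (h := pow2_ge_0 c); lra |].
  assert (h1 := sum_n_Cmod_le_norm (M' f) N).
  assert (h2 : ell2_norm (M' f) ^ 2 <= m ^ 2 * ell2_norm f ^ 2).
  { rewrite <- Rpow_mult_distr; apply pow_incr; split; [apply ell2_norm_ge0 | apply hMn]. }
  assert (h3 : sum_n r N <= ell2_norm f ^ 2).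
  { destruct N as [| N].
    - rewrite sum_O; apply pow2_ge_0.
    - apply Rle_trans with (2 := sum_n_Cmod_le_norm f N); right.
      (* Since [r 0 = 0], removing the first term and shifting the index leaves the sum for [f] up
         to [N]. *)
      unfold sum_n at 1; rewrite sum_Sn_m, <- sum_n_m_S by lia.
      apply Rplus_0_l. }
  lra.
Qed.

(** The telescoping bound with [K] makes [M] bounded; the two bounds by [c] make the diagonal and
    shift parts of [T] bounded. *)
Lemma weighted_mean_coposinormal (w : nat -> R) (K c : R) :
  (forall n, 0 < w n) -> 0 < K ->
  (forall n, / sum_n w n <= K * (/ w n - / w (S n))) ->
  (forall n, Rabs (adjoint_quotient_diag w n) <= c) ->
  (forall n, w n <= c * w (S n)) ->
  exists M : ell2 -> ell2,
    matrix_operator (weighted_mean_matrix w) M /\ coposinormal M.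
Proof.
intros hw hK hKw hd hr.
destruct (weighted_mean_operator_exists w K hw hK hKw) as [M [hM hMw]].
destruct (adjoint_exists M hM) as [M' [hM' hadj]].
destruct (adjoint_quotient_operator_exists w M' c hw hM' hd hr) as [T [hT hTq]].
exists M; split.
- intros f i; rewrite hMw; apply weighted_mean_is_series.
- apply (coposinormal_of_factorization M M' T hM hM' hT hadj).
  intros f; apply ell2_eq; intros n.
  rewrite hMw, <- (weighted_mean_adjoint_quotient w M M' f n hw hadj hMw).
  unfold weighted_mean; f_equal; apply sum_n_ext; intros j; now rewrite hTq.
Qed.

(** * Affine weights *)

Lemma sum_n_affine (a b : R) (n : nat) :
  sum_n (fun n => a * INR n + b) n = (INR n + 1) * (a * INR n + 2 * b) / 2 :> R.
Proof.
induction n as [| n IH].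
- rewrite sum_O; simpl; lra.
- etransitivity; [apply sum_Sn |]; rewrite IH, S_INR; change plus with Rplus; field.
Qed.

Theorem theorem3p2 (a b : R) (ha : 0 < a) (hb : 0 < b) :
  exists M : ell2 -> ell2,
    matrix_operator (weighted_mean_matrix (fun n : nat => a * INR n + b)) M /\
    coposinormal M.
Proof.
(* Since [1 / w_n - 1 / w_(n+1) = a / (w_n w_(n+1))], this [K] reduces the first bound to
   [w_n w_(n+1) <= 2 (a + b) W_n]. The value [c := 2] comes from the diagonal entries. *)
apply weighted_mean_coposinormal with (K := 2 * (a + b) / a) (c := 2).
- intros n; assert (hn := pos_INR n); nra.
- apply Rdiv_lt_0_compat; lra.
- intros n; rewrite sum_n_affine, S_INR.
  assert (hn := pos_INR n); set (x := INR n) in *.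
  assert (hw : 0 < a * x + b) by nra.
  assert (hwS : 0 < a * (x + 1) + b) by nra.
  replace (2 * (a + b) / a * (/ (a * x + b) - / (a * (x + 1) + b)))
    with (/ ((a * x + b) * (a * (x + 1) + b) / (2 * (a + b)))) by (field; lra).
  apply Rinv_le_contravar.
  + apply Rdiv_lt_0_compat; [now apply Rmult_lt_0_compat | lra].
  + apply Rle_div_l; [lra |].
    (* Compared factor by factor: [a x + b <= a x + 2 b] and [a (x + 1) + b <= (x + 1) (a + b)]. *)
    apply Rle_trans with ((a * x + 2 * b) * ((x + 1) * (a + b))); [| right; field].
    apply Rmult_le_compat; [nra | nra | lra | nra].
- intros [| k]; [simpl; rewrite Rabs_R1; lra |].
  unfold adjoint_quotient_diag; rewrite !sum_n_affine, S_INR.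
  assert (hk := pos_INR k); set (x := INR k) in *.
  assert (hw : 0 < a * (x + 1) + b) by nra.
  assert (hw2 := pow_lt _ 2 hw).
  set (W := (x + 1) * (a * x + 2 * b) / 2).
  (* Here [W] is [W_k]. Substituting [W_(k+1) = W_k + w_(k+1)] and [w_k = w_(k+1) - a] turns the
     numerator into [w_(k+1)^2 + a W_k], and [a W_k <= w_(k+1)^2] yields the bound [2]. *)
  replace (_ - _) with ((a * (x + 1) + b) ^ 2 + a * W) by (unfold W; field).
  assert (hW : 0 <= W).
  { unfold W; apply Rmult_le_pos; [apply Rmult_le_pos; nra | lra]. }
  rewrite Rabs_pos_eq.
  + apply Rle_div_l; [assumption |].
    unfold W; nra.
  + apply Rdiv_le_0_compat; [nra | assumption].
- intros n; rewrite S_INR; assert (hn := pos_INR n); nra.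
Qed.
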